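(* Let $T, S \in \mathcal{B}(\mathcal{H})$ and let $f: (0,1)\rightarrow [0,\infty)$ be any function. Then for any sub-multiplicative Orlicz function $\phi$ and every $t\in(0,1)$, \begin{align*} \phi\left(w^2(T^*S)\right) \leq{}& \frac{1}{2(1+ f(t))}\, \phi\left(w(T^*S)\right) \left\| \phi(|T|^2) + \phi(|S|^2) \right\| \\ & + \frac{f(t)}{2(1+f(t))}\, \phi\left(w(|S|^2 |T|^2)\right) + \frac{f(t)}{4(1+f(t))} \left\| \phi(|T|^4) + \phi(|S|^4) \right\| . \end{align*}
   Context: $\mathcal{B}(\mathcal{H})$ is the algebra of bounded linear operators on a complex Hilbert space $\mathcal{H}$. For $T\in\mathcal{B}(\mathcal{H})$, $T^*$ is the adjoint, $|T|=(T^*T)^{1/2}$, $\|T\|$ is the operator norm, $w(T)=\sup_{\|x\|=1}|\langle Tx,x\rangle|$ is the numerical radius, and $w^2(T)=(w(T))^2$. For a positive operator $A$, $\phi(A)$ is defined by the continuous functional calculus. An Orlicz function is a continuous, convex, increasing function $\phi:[0,\infty)\to[0,\infty)$ with $\phi(0)=0$, $\phi(t)>0$ for all $t>0$, and $\lim_{t\to\infty}\phi(t)=\infty$. It is sub-multiplicative if $\phi(t_1t_2)\le\phi(t_1)\phi(t_2)$ for all $t_1,t_2\ge 0$. *)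

(* Defs.v *)
From HB Require Import structures.
From mathcomp Require Import all_boot all_order all_algebra.
From mathcomp Require Import all_classical all_reals all_analysis.
From mathcomp Require Import complex.

Set Implicit Arguments.
Unset Strict Implicit.
Unset Printing Implicit Defensive.

Import Order.TTheory GRing.Theory Num.Theory.
Import numFieldNormedType.Exports.

Local Open Scope classical_set_scope.
Local Open Scope complex_scope.
Local Open Scope ring_scope.

(* A complex Hilbert space. The inner product is linear in its first argument
   and conjugate-linear in the second. *)
HB.mixin Record isHilbert (R : realType) H & CompleteNormedModule R[i] H := {
  inner : {dot H for (@Num.conj R[i] : R[i] -> R[i])};
  inner_norm : forall x : H, inner x x = `|x| ^+ 2
}.

#[short(type="hilbertType")]
HB.structure Definition Hilbert (R : realType) :=
  {H of CompleteNormedModule R[i] H & isHilbert R H}.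

Section Operators.
Context {R : realType} {H : hilbertType R}.
Implicit Types (A B : H -> H).

(* Membership in B(H). *)
Definition bounded_op A : Prop :=
  linear A /\ exists M : R, forall x, `|A x| <= M%:C * `|x|.

(* The norm of H takes its values in the nonnegative reals of R[i];
   complex.Re brings them back to R. *)
Definition opnorm A : R :=
  sup [set complex.Re `|A x| | x in [set x : H | `|x| <= 1]].

(* On the zero space the supremum is over the empty set, hence is 0. *)
Definition numrad A : R :=
  sup [set complex.Re `|inner (A x) x| | x in [set x : H | `|x| = 1]].

(* The adjoint of a bounded operator is unique and exists by the Riesz
   representation theorem; 0 is a default value, not used for such operators. *)
Definition adjoint A : H -> H :=
  xget 0 [set B | bounded_op B /\ forall x y, inner (A x) y = inner x (B y)].

Definition spectrum A : set R[i] :=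
  [set z | ~ exists B, [/\ bounded_op B,
     (forall x, B (A x - z *: x) = x) & (forall x, A (B x) - z *: B x = x)]].

(* p(A) *)
Definition poly_op (p : {poly R}) A : H -> H :=
  fun x => \sum_(i < size p) (p`_i)%:C *: iter i A x.

(* Continuous functional calculus of a self-adjoint operator A (whose spectrum
   is real): g(A) is the limit in operator norm of p_n(A), for polynomials p_n
   converging to g uniformly on the spectrum of A. *)
Definition is_cfc A (g : R -> R) B : Prop :=
  bounded_op B /\
  exists p : nat -> {poly R},
    {uniform [set t : R | spectrum A t%:C],
       (fun n t => (p n).[t]) @ \oo --> g} /\
    (fun n => opnorm (poly_op (p n) A - B)) @ \oo --> (0 : R).

Definition cfc (g : R -> R) A : H -> H := xget 0 [set B | is_cfc A g B].

(* |A| = (A^* A)^(1/2) *)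
Definition absop A : H -> H := cfc Num.sqrt (adjoint A \o A).

End Operators.

(* A function from [0, oo) to [0, oo) is represented by a function on R whose
   values at negative arguments are irrelevant. *)
Record orlicz {R : realType} (phi : R -> R) : Prop := Orlicz {
  orlicz_ge0 : forall t : R, 0 <= t -> 0 <= phi t;
  orlicz_continuous : {within `[0, +oo[, continuous phi};
  orlicz_convex : @convex_function R R^o `[0, +oo[ phi;
  orlicz_increasing : {in `[0, +oo[ &, {homo phi : s t / s <= t}};
  orlicz0 : phi 0 = 0;
  orlicz_gt0 : forall t : R, 0 < t -> 0 < phi t;
  orlicz_pinfty : phi t @[t --> +oo] --> +oo
}.

Definition submultiplicative {R : realType} (phi : R -> R) : Prop :=
  forall s t : R, 0 <= s -> 0 <= t -> phi (s * t) <= phi s * phi t.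

(* Main.v *)
Require Import Defs.
From mathcomp Require Import all_boot all_order all_algebra.
From mathcomp Require Import all_classical all_reals all_analysis.
From mathcomp Require Import complex ring lra.
Import Order.TTheory GRing.Theory Num.Theory.
Import numFieldNormedType.Exports.
Local Open Scope ring_scope.
Set Implicit Arguments.
Unset Strict Implicit.
Unset Printing Implicit Defensive.
Local Open Scope complex_scope.

(* For a unit vector x put v = |<T^* S x, x>| = |<S x, T x>|, A = T^* T = |T|^2
   and B = S^* S = |S|^2. Cauchy-Schwarz gives
   v^2 <= w(T^* S) (<A x, x> + <B x, x>) / 2, while Buzano's inequality
   |<a, x> <x, b>| <= (|a| |b| + |<a, b>|) / 2 applied to a = A x, b = B x gives
   v^2 <= (w(B A) + (<A^2 x, x> + <B^2 x, x>) / 2) / 2. Apply phi, which is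
   increasing, convex and sub-multiplicative, use Jensen's inequality
   phi(<C x, x>) <= <phi(C) x, x> for C positive, and average the two bounds on
   phi(v^2) with the weights 1 / (1 + f t) and f t / (1 + f t).

   The functional calculus of a positive operator A rests on the bound
   <p(A) x, x> <= max p on the spectrum, for x a unit vector and p a real
   polynomial: the supremum m of the form is an approximate eigenvalue of p(A),
   so the factorization of p - m over the complex numbers has a root that lies
   in the spectrum of A. Together with Bernstein's polynomial approximation this
   yields the existence of g(A), the identity sqrt(A)^2 = A, and Jensen's
   inequality by approximating a supporting line. *)

(** * Real geometry of a complex Hilbert space *)

Section Geometry.
Context {R : realType} {H : hilbertType R}.
Implicit Types (x y z : H) (r : R).

(** Real-valued norm and inner product, so that order reasoning takes place in [R] rather than in
    [R[i]]. *)
Definition nrm x : R := complex.Re `|x|.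
Definition rip x y : R := complex.Re (inner x y).

Lemma nrmE x : `|x| = (nrm x)%:C.
Proof. by rewrite RRe_real // ger0_real. Qed.

Lemma nrm_ge0 x : 0 <= nrm x.
Proof. by rewrite -ler0c -nrmE. Qed.

Lemma nrm0 : nrm 0 = 0.
Proof. by rewrite /nrm normr0. Qed.

Lemma nrm_eq0 x : (nrm x == 0) = (x == 0).
Proof. by rewrite -[RHS]normr_eq0 nrmE (inj_eq (@complexI R)). Qed.

Lemma nrm_gt0 x : (0 < nrm x) = (x != 0).
Proof. by rewrite lt_def nrm_ge0 andbT nrm_eq0. Qed.

Lemma nrmD x y : nrm (x + y) <= nrm x + nrm y.
Proof. by have := ler_normD x y; rewrite !nrmE -rmorphD lecR. Qed.

Lemma nrmN x : nrm (- x) = nrm x.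
Proof. by rewrite /nrm normrN. Qed.

Lemma nrmB x y : nrm (x - y) = nrm (y - x).
Proof. by rewrite -nrmN opprB. Qed.

Lemma nrmZ (a : R[i]) x : nrm (a *: x) = complex.Re `|a| * nrm x.
Proof.
rewrite /nrm normrZ -/(nrm _) (nrmE x) -[`|a|]RRe_real ?ger0_real //.
by rewrite -rmorphM.
Qed.

Lemma nrmZr r x : nrm (r%:C *: x) = `|r| * nrm x.
Proof. by rewrite nrmZ normc_def /= expr0n addr0 sqrtr_sqr. Qed.

Lemma ripDl x y z : rip (x + y) z = rip x z + rip y z.
Proof. by rewrite /rip linearDl raddfD. Qed.

Lemma innerC x y : inner x y = (inner y x)^*.
Proof. by have := hermC (inner : {dot H for _}) x y; rewrite mul1r. Qed.

Lemma ripC x y : rip x y = rip y x.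
Proof. by rewrite /rip innerC; case: (inner y x). Qed.

Lemma ripDr x y z : rip x (y + z) = rip x y + rip x z.
Proof. by rewrite ripC ripDl !(ripC x). Qed.

Lemma ripZl r x y : rip (r%:C *: x) y = r * rip x y.
Proof. by rewrite /rip linearZl_LR /=; case: (inner x y) => a b /=; lra. Qed.

Lemma ripZr r x y : rip x (r%:C *: y) = r * rip x y.
Proof. by rewrite ripC ripZl ripC. Qed.

Lemma ripNl x y : rip (- x) y = - rip x y.
Proof.
rewrite -[- x]scaleN1r -[-1 as X in X *: _](rmorphN1 (real_complex R)).
by rewrite ripZl mulN1r.
Qed.

Lemma rip0l x : rip 0 x = 0.
Proof. by have := ripNl 0 x; rewrite oppr0; lra. Qed.

Lemma ripNr x y : rip x (- y) = - rip x y.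
Proof. by rewrite ripC ripNl ripC. Qed.

Lemma ripBl x y z : rip (x - y) z = rip x z - rip y z.
Proof. by rewrite ripDl ripNl. Qed.

Lemma ripBr x y z : rip x (y - z) = rip x y - rip x z.
Proof. by rewrite ripDr ripNr. Qed.

Lemma rip_nrm x : rip x x = nrm x ^+ 2.
Proof. by rewrite /rip inner_norm nrmE -rmorphXn. Qed.

Lemma rip_i x y : rip ('i *: x) y = - complex.Im (inner x y).
Proof. by rewrite /rip linearZl_LR /=; case: (inner x y) => a b /=; lra. Qed.

(** The imaginary part is, up to sign, the real form at ['i *: x]; identities for [rip] between
    linear operators therefore lift to [inner]. *)
Lemma innerE x y : inner x y = Complex (rip x y) (- rip ('i *: x) y).
Proof. by rewrite rip_i opprK /rip; case: (inner x y). Qed.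

Lemma rip_iC x y : rip ('i *: x) y = - rip x ('i *: y).
Proof.
rewrite [rip x _]ripC !rip_i opprK innerC.
by case: (inner y x) => a b /=; rewrite opprK.
Qed.

Lemma nrmD_sqr x y : nrm (x + y) ^+ 2 = nrm x ^+ 2 + 2 * rip x y + nrm y ^+ 2.
Proof. by rewrite -!rip_nrm ripDl !ripDr (ripC y x); ring. Qed.

Lemma rip_le x y : rip x y <= nrm x * nrm y.
Proof.
have [->|x0] := eqVneq x 0; first by rewrite nrm0 mul0r rip0l.
have [->|y0] := eqVneq y 0; first by rewrite nrm0 mulr0 ripC rip0l.
have nx : 0 < nrm x by rewrite nrm_gt0.
have ny : 0 < nrm y by rewrite nrm_gt0.
(* This square expands to [2 * (nrm x * nrm y) * (nrm x * nrm y - rip x y)]. *)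
have := sqr_ge0 (nrm ((nrm y)%:C *: x + (- nrm x)%:C *: y)).
rewrite nrmD_sqr !nrmZr normrN !gtr0_norm // ripZl ripZr => h.
have {h} : 0 <= (nrm x * nrm y) * (nrm x * nrm y - rip x y) by nra.
by rewrite pmulr_rge0 ?mulr_gt0 // subr_ge0.
Qed.

Lemma norm_rip_le x y : `|rip x y| <= nrm x * nrm y.
Proof. by rewrite ler_norml rip_le andbT lerNl -ripNr -(nrmN y) rip_le. Qed.

Lemma rip_le_inner x y : rip x y <= complex.Re `|inner x y|.
Proof.
have := normc_ge_Re (inner x y).
rewrite -[`|inner x y|]RRe_real ?ger0_real // lecR.
by apply: le_trans; rewrite ler_norm.
Qed.

Lemma inner_le x y : complex.Re `|inner x y| <= nrm x * nrm y.
Proof.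
have [->|z0] := eqVneq (inner x y) 0.
  by rewrite normr0 mulr_ge0 ?nrm_ge0.
set z := inner x y; have n0 : `|z| != 0 by rewrite normr_eq0.
(* Multiplying [x] by the unit phase conjugate to [z] turns the inner product into its modulus, so
   the real Cauchy-Schwarz inequality applies. *)
have <- : rip ((z^* / `|z|) *: x) y = complex.Re `|z|.
  rewrite /rip; suff -> : inner ((z^* / `|z|) *: x) y = `|z| by [].
  transitivity (z^* / `|z| * z); first exact: linearZl_LR.
  by apply: (mulIf n0); rewrite mulrAC divfK // mulrC -sqr_normc expr2.
apply: le_trans (rip_le _ _) _; rewrite nrmZ normrM normrV ?unitfE // normr_id.
by rewrite normcJ mulfV // mul1r.
Qed.

(** Twice the projection of [a] onto [x], minus [a], is a reflection of [a] and has the same norm;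
    Cauchy-Schwarz against [b] gives the bound. *)
Lemma buzano_real a b x : nrm x = 1 ->
  rip a x * rip x b <= (nrm a * nrm b + rip a b) / 2.
Proof.
move=> x1; have := rip_le (2%:C *: ((rip x a)%:C *: x) + - a) b.
have -> : nrm (2%:C *: ((rip x a)%:C *: x) + - a) = nrm a.
  apply/eqP; rewrite -(@eqrXn2 _ 2) ?nrm_ge0 //; apply/eqP.
  rewrite nrmD_sqr !nrmZr ripNr nrmN !ripZl !exprMn !real_normK ?num_real // x1; ring.
by rewrite ripDl !ripZl ripNl (ripC a x); lra.
Qed.

Lemma complete_nrm (u : nat -> H) :
  (forall e : R, 0 < e -> exists N, forall m n, (N <= m)%N -> (N <= n)%N ->
     nrm (u m - u n) < e) ->
  exists z, forall e : R, 0 < e -> exists N, forall n, (N <= n)%N -> nrm (u n - z) < e.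
Proof.
move=> cu.
have : cauchy (u @ \oo)%classic.
  apply: cauchy_exP => e e0.
  have [r r0 ->] : exists2 r : R, 0 < r & e = r%:C.
    by exists (complex.Re e); rewrite -?ltcR RRe_real ?gtr0_real.
  have [N hN] := cu _ r0.
  exists (u N), N => // n /= Nn.
  by rewrite -ball_normE /= nrmE ltcR hN.
move=> /cauchy_cvgP cvu.
exists (lim (u @ \oo)%classic) => e e0.
move/cvgrPdist_lt : cvu => /(_ e%:C).
rewrite ltcR => /(_ e0) [N _ hN].
by exists N => n /hN /=; rewrite nrmE ltcR nrmB.
Qed.

End Geometry.

(** * Minimisation of coercive quadratic functionals *)

Lemma small_invn (R : realType) (e : R) : 0 < e ->
  exists N, forall n, (N <= n)%N -> (n.+1%:R^-1 : R) < e.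
Proof.
move=> e0; exists (Num.bound e^-1) => n Nn.
rewrite invf_plt ?posrE //; apply: lt_le_trans (archi_boundP _) _.
  by rewrite invr_ge0 ltW.
by rewrite ler_nat ltnW // ltnS.
Qed.

Section BoundedOperators.
Context {R : realType} {H : hilbertType R}.
Implicit Types (x y z : H) (r : R) (A B C : H -> H).

Definition symmetric_op A := forall x y, rip (A x) y = rip x (A y).

Lemma bounded_opP A : bounded_op A <->
  linear A /\ exists2 M : R, 0 <= M & forall x, nrm (A x) <= M * nrm x.
Proof.
split=> -[lA [M]].
  move=> hM; split=> //; exists `|M| => // x.
  have := hM x; rewrite !nrmE -rmorphM lecR => /le_trans; apply.
  by rewrite ler_wpM2r ?nrm_ge0 // ler_norm.
by move=> _ hM; split=> //; exists M => x; rewrite !nrmE -rmorphM lecR.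
Qed.

Lemma linopD A x y : linear A -> A (x + y) = A x + A y.
Proof. by move=> lA; have := lA 1 x y; rewrite !scale1r. Qed.

Lemma linop0 A : linear A -> A 0 = 0.
Proof. by move=> lA; have := lA (-1) 0 0; rewrite !scaleN1r !addNr. Qed.

Lemma linopZ A a x : linear A -> A (a *: x) = a *: A x.
Proof. by move=> lA; have := lA a x 0; rewrite (linop0 lA) !addr0. Qed.

Lemma linopN A x : linear A -> A (- x) = - A x.
Proof. by move=> lA; rewrite -scaleN1r linopZ // scaleN1r. Qed.

Lemma linopB A x y : linear A -> A (x - y) = A x - A y.
Proof. by move=> lA; rewrite linopD // linopN. Qed.

Lemma inner_rip A B : linear A -> linear B ->
  (forall x y, rip (A x) y = rip x (B y)) ->
  forall x y, inner (A x) y = inner x (B y).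
Proof. by move=> lA lB AB x y; rewrite !innerE AB -linopZ // AB. Qed.

Lemma rip_ext x y : (forall z, rip x z = rip y z) -> x = y.
Proof.
move=> h; apply/eqP; rewrite -subr_eq0 -nrm_eq0 -sqrf_eq0 -rip_nrm.
by rewrite ripBl h subrr.
Qed.

(* The vector z is found by minimising [rip (C x) x - 2 * l x]. With C the
   identity this is the Riesz representation theorem; with [l := rip y] it
   solves C z = y. *)
Lemma coercive_representation C (l : H -> R) (d K : R) :
  bounded_op C -> symmetric_op C -> 0 < d ->
  (forall x, d * nrm x ^+ 2 <= rip (C x) x) ->
  (forall x y, l (x + y) = l x + l y) ->
  (forall r x, l (r%:C *: x) = r * l x) ->
  (forall x, l x <= K * nrm x) ->
  exists z, forall x, l x = rip (C z) x.
Proof.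
move=> /bounded_opP [lC [M M0 hM]] sC d0 hd lD lZ lK.
pose Q x : R := rip (C x) x; pose F x : R := Q x - 2 * l x.
have FDs x y s : F (x + s%:C *: y) = F x + 2 * s * (rip (C x) y - l y) + s ^+ 2 * Q y.
  rewrite /F /Q linopD // linopZ // lD lZ !ripDl !ripDr !ripZl !ripZr.
  by rewrite (sC y x) (ripC y); ring.
(* Parallelogram law for [F]: the linear terms cancel, so the distance of two near-minimisers is
   controlled by the excess of their values over the infimum. *)
have par x y : Q (x - y) = 2 * F x + 2 * F y - 4 * F ((2^-1)%:C *: (x + y)).
  rewrite /F /Q linopB // linopZ // linopD // lZ lD.
  rewrite !ripZl !ripZr !ripBl !ripBr !ripDl !ripDr; by field.
have hinf : has_inf (range F).
  split; first by exists (F 0), 0.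
  (* Completing the square: [d * F v] is at least [(d * nrm v - K) ^+ 2 - K ^+ 2]. *)
  exists (- (K ^+ 2 / d)) => w; case=> v _ <-; rewrite /F /Q.
  rewrite -(ler_pM2l d0) mulrN mulrCA mulfV ?gt_eqF // mulr1.
  have := hd v; have := lK v; have := sqr_ge0 (d * nrm v - K).
  have := nrm_ge0 v; nra.
pose i0 : R := inf (range F).
have hlb x : i0 <= F x by apply: ge_inf; [case: hinf|exists x].
have [u hu] : {u : nat -> H & forall k, F (u k) < i0 + k.+1%:R^-1}.
  apply: (@choice _ _ (fun k v => F v < i0 + k.+1%:R^-1)) => k.
  have k0 : 0 < k.+1%:R^-1 :> R by rewrite invr_gt0.
  have [w [v _ <-] hv] := inf_adherent k0 hinf.
  by exists v.
have [z hz] : exists z, forall e : R, 0 < e ->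
    exists N, forall n, (N <= n)%N -> nrm (u n - z) < e.
  apply: complete_nrm => e e0.
  have de0 : 0 < d * e ^+ 2 / 4 by rewrite divr_gt0 // mulr_gt0 // exprn_gt0.
  have [N hN] := small_invn de0.
  exists N => m n /hN hm /hN hn.
  rewrite -(@ltr_pXn2r _ 2) ?nnegrE ?nrm_ge0 ?(ltW e0) // -(ltr_pM2l d0).
  apply: le_lt_trans (hd _) _; rewrite -/(Q _) par.
  have aux (a b c i j k D : R) : j < D / 4 -> k < D / 4 -> b < i + j ->
      c < i + k -> i <= a -> 2 * b + 2 * c - 4 * a < D by lra.
  exact: aux hm hn (hu m) (hu n) (hlb _).
exists z => x.
(* First-order condition at the limit: [F (u n + s%:C *: x)] is at least the infimum, which
   [F (u n)] nearly attains, and boundedness of [C] lets the cross term converge. *)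
have key s : 0 <= 2 * s * (rip (C z) x - l x) + s ^+ 2 * Q x.
  apply/ler_addgt0Pr => e e0.
  have [N1 h1] := small_invn (ltac:(by rewrite divr_gt0) : 0 < e / 2).
  pose c := 4 * (`|s| * M * nrm x) + 1.
  have c0 : 0 < c by rewrite ltr_wpDl // !mulr_ge0 ?nrm_ge0.
  have [N2 h2] := hz (e / c) (ltac:(by rewrite divr_gt0)).
  pose n := maxn N1 N2.
  have := h1 n (leq_maxl _ _); have := h2 n (leq_maxr _ _).
  have := hlb (u n + s%:C *: x); rewrite FDs; have := hu n.
  have : `|s * rip (C (u n - z)) x| <= `|s| * M * nrm x * nrm (u n - z).
    rewrite normrM -!mulrA ler_wpM2l //; apply: le_trans (norm_rip_le _ _) _.
    by rewrite [nrm x * _]mulrC mulrA ler_wpM2r ?nrm_ge0.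
  have : 4 * (`|s| * M * nrm x) * nrm (u n - z) <= c * nrm (u n - z).
    by rewrite ler_wpM2r ?nrm_ge0 // lerDl.
  rewrite linopB // ripBl ler_norml => b0 /andP[_ b1] b2 b3 b4 b5.
  have {}b4 : c * nrm (u n - z) < e by rewrite mulrC -ltr_pdivlMr.
  have aux (p q i j P D r Fu w : R) : 4 * (p * D) <= c * D -> s * (q - r) <= p * D ->
     Fu < i + j -> i <= Fu + 2 * s * (q - w) + P -> c * D < e -> j < e / 2 ->
     0 <= 2 * s * (r - w) + P + e by nra.
  rewrite -mulrA in b0.
  exact: aux b0 b1 b2 b3 b4 b5.
pose g := rip (C z) x - l x.
have Q0 : 0 <= Q x by apply: le_trans (hd x); rewrite mulr_ge0 ?sqr_ge0 ?ltW.
have q1 : Q x + 1 != 0 by rewrite gt_eqF // ltr_wpDl.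
(* Near-minimiser of the quadratic in [s]; the added 1 keeps the denominator positive when [Q x]
   vanishes. *)
have := key (- g / (Q x + 1)); rewrite -/g.
have -> : 2 * (- g / (Q x + 1)) * g + (- g / (Q x + 1)) ^+ 2 * Q x =
  - (g ^+ 2 * (Q x + 2) / (Q x + 1) ^+ 2) by field.
rewrite oppr_ge0 pmulr_lle0 ?invr_gt0 ?exprn_gt0 ?ltr_wpDl // => hg.
have : g ^+ 2 * (Q x + 2) == 0 by rewrite eq_le hg mulr_ge0 ?sqr_ge0 // addr_ge0.
rewrite mulf_eq0 sqrf_eq0 => /orP[|/eqP]; last by lra.
by rewrite subr_eq0 => /eqP ->.
Qed.

End BoundedOperators.

(** * Adjoints, inverses and the location of the spectrum *)

Section Adjoint.
Context {R : realType} {H : hilbertType R}.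
Implicit Types (x y z : H) (r : R) (A B C : H -> H).

Lemma rip_conj (a : R[i]) x y : rip (a *: x) y = rip x (a^* *: y).
Proof.
have scal (b : R[i]) u v : inner (b *: u) v = b * inner u v :> R[i] by exact: linearZl_LR.
rewrite [RHS]ripC /rip !scal (innerC y x).
by case: a (inner x y) => a1 a2 [b1 b2] /=; ring.
Qed.

Lemma bounded_op_id : bounded_op (idfun : H -> H).
Proof. by apply/bounded_opP; split => //; exists 1 => // x; rewrite mul1r. Qed.

Lemma bounded_opD A B : bounded_op A -> bounded_op B -> bounded_op (A + B).
Proof.
move=> /bounded_opP[lA [M M0 hM]] /bounded_opP[lB [N N0 hN]].
apply/bounded_opP; split.
  move=> a x y; change (A (a *: x + y) + B (a *: x + y) =
    a *: (A x + B x) + (A y + B y)).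
  by rewrite lA lB scalerDr addrACA.
exists (M + N) => [|x]; first exact: addr_ge0.
by rewrite mulrDl (le_trans (nrmD _ _)) // lerD.
Qed.

Lemma bounded_opZ (a : R[i]) A : bounded_op A -> bounded_op (fun x => a *: A x).
Proof.
move=> /bounded_opP[lA [M M0 hM]]; apply/bounded_opP; split.
  by move=> b x y; rewrite lA scalerDr !scalerA mulrC.
have a0 : 0 <= complex.Re `|a| by rewrite normc_def /= sqrtr_ge0.
exists (complex.Re `|a| * M) => [|x]; first exact: mulr_ge0.
by rewrite nrmZ -mulrA ler_wpM2l.
Qed.

Lemma bounded_opB A B : bounded_op A -> bounded_op B -> bounded_op (A - B).
Proof.
move=> bA bB; have -> : A - B = A + (fun x => -1 *: B x).
  by apply/funext => x; rewrite -[RHS]/(A x + -1 *: B x) scaleN1r.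
by apply: bounded_opD => //; exact: bounded_opZ.
Qed.

Lemma bounded_op_comp A B : bounded_op A -> bounded_op B -> bounded_op (A \o B).
Proof.
move=> /bounded_opP[lA [M M0 hM]] /bounded_opP[lB [N N0 hN]].
apply/bounded_opP; split => [a x y|]; first by rewrite /= lB lA.
exists (M * N) => [|x]; first exact: mulr_ge0.
by rewrite /= -mulrA (le_trans (hM _)) // ler_wpM2l.
Qed.

(** Riesz representation of each real functional [rip (A x) y] supplies the values of the adjoint;
    [rip_conj] restores complex linearity. *)
Lemma adjointP A : bounded_op A ->
  bounded_op (adjoint A) /\ forall x y, inner (A x) y = inner x (adjoint A y).
Proof.
move=> bA; have /bounded_opP[lA [M M0 hM]] := bA.
have [B hB] : {B : H -> H & forall y x, rip (A x) y = rip (B y) x}.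
  apply: (@choice _ _ (fun y z => forall x, rip (A x) y = rip z x)) => y.
  apply: (@coercive_representation _ _ idfun _ 1 (M * nrm y)) => //.
  - exact: bounded_op_id.
  - by move=> x; rewrite mul1r rip_nrm.
  - by move=> u v; rewrite linopD // ripDl.
  - by move=> r u; rewrite linopZ // ripZl.
  - by move=> x; apply: le_trans (rip_le _ _) _; rewrite mulrAC ler_wpM2r ?nrm_ge0.
suff : ([set B | bounded_op B /\ forall x y, inner (A x) y = inner x (B y)]
  (adjoint A))%classic by [].
apply: (@xgetPex _ 0); exists B.
have lB : linear B.
  move=> a u v; apply: rip_ext => w.
  by rewrite -hB ripDr ripDl rip_conj -!hB linopZ // rip_conj conjCK.
split; last by apply: inner_rip => // x y; rewrite hB ripC.
apply/bounded_opP; split=> //; exists M => // y.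
have [->|y0] := eqVneq (B y) 0; first by rewrite nrm0 mulr_ge0 ?nrm_ge0.
rewrite -(ler_pM2r (_ : 0 < nrm (B y))) ?nrm_gt0 // -expr2 -rip_nrm -hB.
apply: le_trans (rip_le _ _) _; rewrite mulrAC ler_wpM2r ?nrm_ge0 //.
Qed.

(** A Lax-Milgram argument: representing [rip y] through [C] gives surjectivity, while coercivity
    gives injectivity and the bound [d^-1] on the inverse. *)
Lemma coercive_inverse C (d : R) :
  bounded_op C -> symmetric_op C -> 0 < d ->
  (forall x, d * nrm x ^+ 2 <= rip (C x) x) ->
  exists B, [/\ bounded_op B, cancel C B & cancel B C].
Proof.
move=> bC sC d0 hd; have /bounded_opP[lC _] := bC.
have [B hB] : {B : H -> H & forall y, C (B y) = y}.
  apply: (@choice _ _ (fun y z => C z = y)) => y.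
  have [z hz] : exists z, forall x, rip y x = rip (C z) x.
    apply: (@coercive_representation _ _ _ _ d (nrm y)) => //.
    - by move=> u v; rewrite ripDr.
    - by move=> r u; rewrite ripZr.
    - by move=> x; apply: rip_le.
  by exists z; apply: rip_ext => x; rewrite hz.
have injC x y : C x = C y -> x = y.
  move=> Cxy; apply/eqP; rewrite -subr_eq0 -nrm_eq0 -sqrf_eq0.
  rewrite eq_le sqr_ge0 andbT -(pmulr_rle0 _ d0).
  by apply: le_trans (hd _) _; rewrite linopB // Cxy subrr rip0l.
exists B; split => //; last by move=> x; apply: injC; rewrite hB.
apply/bounded_opP; split.
  by move=> a u v; apply: injC; rewrite lC !hB.
exists d^-1; first by rewrite invr_ge0 ltW.
move=> y; rewrite ler_pdivlMl //.
have [->|y0] := eqVneq (B y) 0; first by rewrite nrm0 mulr0 nrm_ge0.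
rewrite -(ler_pM2r (_ : 0 < nrm (B y))) ?nrm_gt0 // -mulrA -expr2.
by apply: le_trans (hd _) _; rewrite hB rip_le.
Qed.

Lemma symmetric_shift A r : symmetric_op A -> symmetric_op (A - (fun x => r%:C *: x)).
Proof.
move=> sA x y; rewrite -[(A - _) x]/(A x - _) -[(A - _) y]/(A y - _).
by rewrite ripBl ripBr ripZl ripZr sA.
Qed.

(** For [t] below [a] the operator [A - t] is coercive, for [t] above [b] its negative is; in both
    cases a bounded inverse exists. *)
Lemma spectrum_range A (a b t : R) : bounded_op A -> symmetric_op A ->
  (forall x, a * nrm x ^+ 2 <= rip (A x) x <= b * nrm x ^+ 2) ->
  spectrum A t%:C -> a <= t <= b.
Proof.
move=> bA sA hab st; pose C : H -> H := A - (fun x => t%:C *: x).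
have CE x : C x = A x - t%:C *: x by [].
have bC : bounded_op C by apply: bounded_opB => //; apply/bounded_opZ/bounded_op_id.
have sC : symmetric_op C by apply: symmetric_shift.
have [at_|ta] /= := leP a t; last first.
  have d0 : 0 < a - t by rewrite subr_gt0.
  have hd x : (a - t) * nrm x ^+ 2 <= rip (C x) x.
    by have /andP[h _] := hab x; rewrite CE ripBl ripZl rip_nrm; lra.
  by case: st; have [B [bB CK BK]] := coercive_inverse bC sC d0 hd; exists B; split.
have [tb|bt] //= := leP t b.
case: st; have bC' : bounded_op (fun x => -1 *: C x) by exact: bounded_opZ.
have sC' : symmetric_op (fun x => -1 *: C x).
  by move=> x y; rewrite !scaleN1r ripNl ripNr sC.
have d0 : 0 < t - b by rewrite subr_gt0.
have hd x : (t - b) * nrm x ^+ 2 <= rip (-1 *: C x) x.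
  by have /andP[_ h] := hab x; rewrite scaleN1r ripNl CE ripBl ripZl rip_nrm; lra.
have [B [bB CK BK]] := coercive_inverse bC' sC' d0 hd.
have /bounded_opP[lB _] := bB; have /bounded_opP[lC _] := bC.
exists (fun x => -1 *: B x); split => [|x|x]; first exact: bounded_opZ.
  by rewrite -linopZ // CK.
by rewrite -CE linopZ // BK.
Qed.

End Adjoint.

(** * Polynomials of an operator *)

Section PolynomialCalculus.
Context {R : realType} {H : hilbertType R}.
Implicit Types (x y z : H) (A B C : H -> H).

(** Complex coefficients allow a splitting into linear factors. *)
Definition cpoly_op (p : {poly R[i]}) A : H -> H :=
  fun x => \sum_(i < size p) p`_i *: iter i A x.

Lemma cpoly_op_wide n (p : {poly R[i]}) A x : (size p <= n)%N ->
  cpoly_op p A x = \sum_(i < n) p`_i *: iter i A x.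
Proof.
move=> pn; rewrite /cpoly_op.
rewrite (big_ord_widen _ (fun i => p`_i *: iter i A x) pn) big_mkcond /=.
by apply: eq_bigr => i _; case: ltnP => // /leq_sizeP/(_ _ (leqnn _)) ->; rewrite scale0r.
Qed.

Lemma cpoly_opD p q A x : cpoly_op (p + q) A x = cpoly_op p A x + cpoly_op q A x.
Proof.
pose n := maxn (size p) (size q).
rewrite (@cpoly_op_wide n (p + q)) ?size_polyD // (@cpoly_op_wide n p) ?leq_maxl //.
rewrite (@cpoly_op_wide n q) ?leq_maxr // -big_split /=.
by apply: eq_bigr => i _; rewrite coefD scalerDl.
Qed.

Lemma cpoly_opZ a p A x : cpoly_op (a *: p) A x = a *: cpoly_op p A x.
Proof.
rewrite (cpoly_op_wide A x (size_scale_leq a p)) scaler_sumr.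
by apply: eq_bigr => i _; rewrite coefZ scalerA.
Qed.

Lemma cpoly_opC c A x : cpoly_op c%:P A x = c *: x.
Proof. by rewrite (cpoly_op_wide A x (size_polyC_leq1 c)) big_ord1 coefC. Qed.

Lemma cpoly_opMX p A x : linear A -> cpoly_op (p * 'X) A x = A (cpoly_op p A x).
Proof.
move=> lA; rewrite (@cpoly_op_wide (size p).+1) ?size_mulX_leq //; last first.
  by rewrite (leq_trans (size_polyMleq _ _)) // size_polyX addn2.
rewrite big_ord_recl coefMX /= scale0r add0r /cpoly_op.
elim/big_ind2 : _ => [|u1 u2 v1 v2 -> ->|i _]; first by rewrite linop0.
  by rewrite linopD.
by rewrite coefMX /= linopZ.
Qed.

Lemma cpoly_opX A x : linear A -> cpoly_op 'X A x = A x.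
Proof. by move=> lA; rewrite -['X]mul1r cpoly_opMX // -polyC1 cpoly_opC scale1r. Qed.

Lemma cpoly_opM p q A x : linear A ->
  cpoly_op (p * q) A x = cpoly_op p A (cpoly_op q A x).
Proof.
move=> lA; elim/poly_ind: p x => [|p c IHp] x.
  by rewrite mul0r -polyC0 !cpoly_opC !scale0r.
rewrite mulrDl mulrAC mul_polyC !cpoly_opD !cpoly_opMX // IHp.
by rewrite cpoly_opZ cpoly_opC.
Qed.

Lemma bounded_cpoly_op p A : bounded_op A -> bounded_op (cpoly_op p A).
Proof.
move=> bA; have [lA _] := bA; elim/poly_ind: p => [|p c IHp].
  rewrite (_ : cpoly_op _ _ = fun x => 0 *: x); first exact/bounded_opZ/bounded_op_id.
  by apply/funext => x; rewrite -polyC0 cpoly_opC.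
rewrite (_ : cpoly_op _ _ = (A \o cpoly_op p A) + (fun x => c *: x)).
  by apply/bounded_opD; [exact: bounded_op_comp|exact/bounded_opZ/bounded_op_id].
by apply/funext => x; rewrite cpoly_opD cpoly_opMX // cpoly_opC.
Qed.

Lemma poly_opE (p : {poly R}) A :
  poly_op p A = cpoly_op (map_poly (real_complex R) p) A.
Proof.
apply/funext => x; rewrite /cpoly_op size_map_poly.
by apply: eq_bigr => i _; rewrite coef_map.
Qed.

Lemma bounded_poly_op (p : {poly R}) A : bounded_op A -> bounded_op (poly_op p A).
Proof. by rewrite poly_opE; exact: bounded_cpoly_op. Qed.

Lemma poly_opM (p q : {poly R}) A x : linear A ->
  poly_op (p * q) A x = poly_op p A (poly_op q A x).
Proof. by move=> lA; rewrite !poly_opE rmorphM cpoly_opM. Qed.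

Lemma poly_opB (p q : {poly R}) A x :
  poly_op (p - q) A x = poly_op p A x - poly_op q A x.
Proof.
rewrite !poly_opE rmorphB cpoly_opD -(scaleN1r (cpoly_op _ _ _)) -cpoly_opZ.
by rewrite scaleN1r.
Qed.

Lemma poly_opD (p q : {poly R}) A x :
  poly_op (p + q) A x = poly_op p A x + poly_op q A x.
Proof. by rewrite !poly_opE rmorphD cpoly_opD. Qed.

Lemma poly_opC (c : R) A x : poly_op c%:P A x = c%:C *: x.
Proof. by rewrite poly_opE map_polyC cpoly_opC. Qed.

Lemma poly_opX A x : linear A -> poly_op 'X A x = A x.
Proof. by move=> lA; rewrite poly_opE map_polyX cpoly_opX. Qed.

Lemma symmetric_poly_op (p : {poly R}) A : linear A -> symmetric_op A ->
  symmetric_op (poly_op p A).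
Proof.
move=> lA sA; elim/poly_ind: p => [|p c IHp] x y.
  by rewrite -polyC0 !poly_opC ripZl ripZr.
rewrite !poly_opD !poly_opC [in LHS]mulrC !poly_opM // !poly_opX //.
by rewrite ripDl ripDr sA IHp ripZl ripZr.
Qed.

(** A real [z] outside the spectrum has a bounded resolvent. For [z = a + i b] with [b] nonzero,
    symmetry makes [(A - a) x] orthogonal to ['i *: x] for [rip], and Pythagoras gives the lower
    bound [|b|]. *)
Lemma linear_factor_bounded_below A (z : R[i]) :
  bounded_op A -> symmetric_op A -> ~ (spectrum A z /\ complex.Im z = 0) ->
  exists2 d : R, 0 < d & forall x, d * nrm x <= nrm (A x - z *: x).
Proof.
move=> bA sA hz; have [z0|z0] := eqVneq (complex.Im z) 0.
  have [B [bB BK _]] : exists B, [/\ bounded_op B,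
     (forall x, B (A x - z *: x) = x) & (forall x, A (B x) - z *: B x = x)].
    by apply: contrapT => h; apply: hz; split.
  have /bounded_opP[lB [N N0 hN]] := bB.
  exists (N + 1)^-1; first by rewrite invr_gt0 ltr_wpDl.
  move=> x; rewrite ler_pdivrMl ?ltr_wpDl // -{1}(BK x).
  by apply: le_trans (hN _) _; rewrite ler_wpM2r ?nrm_ge0 // lerDl.
exists `|complex.Im z|; first by rewrite normr_gt0.
move=> x; rewrite -(@ler_pXn2r _ 2) ?nnegrE ?mulr_ge0 ?nrm_ge0 //.
set a := complex.Re z; set b := complex.Im z.
pose v := A x - a%:C *: x.
have -> : A x - z *: x = v + (- b)%:C *: ('i *: x).
  rewrite (complexE z) -/a -/b scalerDl opprD addrA scalerA; congr (_ - _ + _).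
  by rewrite -scaleNr; congr (_ *: _); rewrite rmorphN mulNr mulrC.
have vi : rip v ('i *: x) = 0.
  have [lA _] := bA.
  have h1 : rip (A x) ('i *: x) = 0.
    have := sA x ('i *: x).
    by rewrite linopZ // -[rip x _]opprK -rip_iC [rip ('i *: x) _]ripC; lra.
  have h2 : rip x ('i *: x) = 0 by have := rip_iC x x; rewrite ripC; lra.
  by rewrite /v ripBl ripZl h1 h2 mulr0 subrr.
rewrite nrmD_sqr ripZr vi mulr0 mulr0 addr0 nrmZr normrN nrmZ.
rewrite (_ : complex.Re `|'i| = 1) ?mul1r ?lerDr ?sqr_ge0 //.
by rewrite normc_def /= expr0n expr1n add0r sqrtr1.
Qed.

End PolynomialCalculus.

(** * Spectral bounds for polynomials of a symmetric operator *)

Section SpectralBound.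
Context {R : realType} {H : hilbertType R}.
Implicit Types (x y z : H) (A B C : H -> H).

(** Over the complex numbers [q] splits into linear factors, each bounded below because no root is a
    real point of the spectrum; the lower bounds multiply. *)
Lemma cpoly_op_bounded_below (q : {poly R[i]}) A :
  bounded_op A -> symmetric_op A -> q != 0 ->
  (forall t : R, spectrum A t%:C -> ~~ root q t%:C) ->
  exists2 d : R, 0 < d & forall x, d * nrm x <= nrm (cpoly_op q A x).
Proof.
move=> bA sA q0 hq; have [lA _] := bA.
have [s qE] := closed_field_poly_normal q.
have hs (z : R[i]) : z \in s -> ~ (spectrum A z /\ complex.Im z = 0).
  move=> zs [sz z0]; have zE : z = (complex.Re z)%:C by case: z z0 {zs sz} => a b /= ->.
  move: sz; rewrite zE => /hq; rewrite -zE qE rootZ ?lead_coef_eq0 //.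
  by rewrite root_prod_XsubC zs.
have : exists2 d : R, 0 < d &
    forall x, d * nrm x <= nrm (cpoly_op (\prod_(z <- s) ('X - z%:P)) A x).
  elim: s hs {qE} => [_|z s IHs hs].
    by exists 1 => // x; rewrite big_nil -polyC1 cpoly_opC scale1r mul1r.
  have [|d d0 hd] := IHs; first by move=> w ws; apply: hs; rewrite inE ws orbT.
  have [|e e0 he] := @linear_factor_bounded_below _ _ A z bA sA.
    by apply: hs; rewrite inE eqxx.
  exists (e * d) => [|x]; first by rewrite mulr_gt0.
  rewrite big_cons cpoly_opM // -polyCN cpoly_opD cpoly_opC scaleNr cpoly_opX //.
  by apply: le_trans (he _); rewrite -mulrA ler_pM2l.
move=> [d d0 hd]; pose a : R := complex.Re `|lead_coef q|.
have a0 : 0 < a by rewrite -ltcR RRe_real ?ger0_real // normr_gt0 lead_coef_eq0.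
exists (a * d) => [|x]; first by rewrite mulr_gt0.
by rewrite qE cpoly_opZ nrmZ -mulrA ler_pM2l.
Qed.

(* Cauchy-Schwarz for the form [rip (N x) y], optimised as the positivity at
   [x - L^-1 N x]. *)
Lemma positive_op_nrm N (L : R) : linear N -> symmetric_op N -> 0 < L ->
  (forall x, nrm (N x) <= L * nrm x) -> (forall x, 0 <= rip (N x) x) ->
  forall x, nrm (N x) ^+ 2 <= L * rip (N x) x.
Proof.
move=> lN sN L0 hL N0 x.
have := N0 (x - L^-1%:C *: N x); rewrite linopB // linopZ //.
rewrite ripBl !ripBr !ripZl !ripZr (sN (N x) x) rip_nrm.
have : rip (N (N x)) (N x) <= L * nrm (N x) ^+ 2.
  by apply: le_trans (rip_le _ _) _; rewrite expr2 mulrA ler_wpM2r ?nrm_ge0.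
move: (rip (N (N x)) (N x)) (rip (N x) x) (nrm (N x) ^+ 2) => a b c h1 h2.
have {}h2 : 0 <= L ^+ 2 * (b - L^-1 * c - (L^-1 * c - L^-1 * (L^-1 * a))).
  by apply: mulr_ge0 h2; apply: sqr_ge0.
have E : L ^+ 2 * (b - L^-1 * c - (L^-1 * c - L^-1 * (L^-1 * a))) =
    L * (L * b - 2 * c) + a by field; rewrite gt_eqF.
rewrite -(ler_pM2l L0); move: h2; rewrite E; nra.
Qed.

(** If [p - m], with [m] the supremum of the form, had no zero on the spectrum, its operator would
    be bounded below, forcing a gap between the form and [m]. The vector [x0] makes the unit sphere
    nonempty. *)
Lemma numerical_sup_attained (p : {poly R}) A x0 :
  bounded_op A -> symmetric_op A -> x0 != 0 -> (1 < size p)%N ->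
  exists t : R, spectrum A t%:C /\
    forall x, rip (poly_op p A x) x <= p.[t] * nrm x ^+ 2.
Proof.
move=> bA sA x00 sp; have [lA _] := bA.
have /bounded_opP[lP [M M0 hM]] := bounded_poly_op p bA.
pose S : set R := [set rip (poly_op p A x) x | x in [set x : H | nrm x = 1]]%classic.
have unit x : x != 0 -> nrm ((nrm x)^-1%:C *: x) = 1.
  move=> xn0; rewrite nrmZr ger0_norm ?invr_ge0 ?nrm_ge0 //.
  by rewrite mulVf // nrm_eq0.
have supS : has_sup S.
  split.
    pose u := (nrm x0)^-1%:C *: x0.
    by exists (rip (poly_op p A u) u), u => //=; exact: unit.
  exists M; move=> _ [x /= x1 <-]; apply: le_trans (rip_le _ _) _.
  by rewrite x1 mulr1; have := hM x; rewrite x1 mulr1.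
pose m : R := sup S.
have hm x : rip (poly_op p A x) x <= m * nrm x ^+ 2.
  have [->|xn0] := eqVneq x 0.
    by rewrite linop0 // rip0l nrm0 expr0n mulr0.
  have : rip (poly_op p A ((nrm x)^-1%:C *: x)) ((nrm x)^-1%:C *: x) <= m.
    apply: ub_le_sup; first by case: supS.
    by exists ((nrm x)^-1%:C *: x) => //=; exact: unit.
  rewrite linopZ // ripZl ripZr mulrA -expr2 exprVn mulrC.
  by rewrite ler_pdivrMr // exprn_gt0 // nrm_gt0.
have [[t [st pt]]|nt] := pselect (exists t : R, spectrum A t%:C /\ p.[t] = m).
  by exists t; split => // x; rewrite pt.
exfalso; pose q := p - m%:P.
(* This is where [p] has to be nonconstant. *)
have q0 : q != 0.
  apply: contraTneq sp => /eqP; rewrite subr_eq0 => /eqP ->.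
  by rewrite -leqNgt size_polyC_leq1.
have [||d d0 hd] := @cpoly_op_bounded_below (map_poly (real_complex R) q) A bA sA.
- by rewrite map_poly_eq0.
- move=> t st; apply/negP; rewrite /root horner_map /= (inj_eq (@complexI R)).
  by rewrite hornerD hornerN hornerC subr_eq0 => /eqP pt; apply: nt; exists t.
pose N : H -> H := poly_op (m%:P - p) A.
have NE x : N x = m%:C *: x - poly_op p A x by rewrite /N poly_opB poly_opC.
have /bounded_opP[lN [L L0 hL]] : bounded_op N by exact: bounded_poly_op.
have hN x : nrm (N x) ^+ 2 <= (L + 1) * rip (N x) x.
  apply: positive_op_nrm => //.
  - exact: symmetric_poly_op.
  - by rewrite ltr_wpDl.
  - by move=> y; apply: le_trans (hL _) _; rewrite ler_wpM2r ?nrm_ge0 // lerDl.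
  - by move=> y; rewrite NE ripBl ripZl rip_nrm subr_ge0.
have L1 : 0 < L + 1 by rewrite ltr_wpDl.
(* On unit vectors [d ^+ 2 <= nrm (N x) ^+ 2 <= (L + 1) * rip (N x) x], so the form of [p] stays
   below [m] by this amount. *)
have e0 : 0 < d ^+ 2 / (L + 1) by rewrite divr_gt0 // exprn_gt0.
have [_ [x /= x1 <-]] := sup_adherent e0 supS.
apply/negP; rewrite -leNgt lerBrDl -lerBrDr ler_pdivrMr // mulrC.
have qN : nrm (poly_op q A x) = nrm (N x) by rewrite -nrmN /N /q !poly_opB opprB.
have := hd x; rewrite x1 mulr1 -poly_opE qN => dN.
have := hN x; rewrite [X in (_ + 1) * rip X x]NE ripBl ripZl rip_nrm x1 expr1n mulr1.
by apply: le_trans; rewrite ler_pXn2r ?nnegrE ?nrm_ge0 ?(ltW d0).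
Qed.

Lemma numerical_sup_spectrum (p : {poly R}) A x0 :
  bounded_op A -> symmetric_op A -> x0 != 0 ->
  exists t : R, spectrum A t%:C /\
    forall x, rip (poly_op p A x) x <= p.[t] * nrm x ^+ 2.
Proof.
move=> bA sA x00; have [sp|] := ltnP 1 (size p);
  first exact: (numerical_sup_attained bA sA x00).
(* For a constant polynomial any point of the spectrum works; the case of ['X] shows that there is
   one. *)
move=> /size1_polyC ->; have [|t [st _]] := @numerical_sup_attained 'X A x0 bA sA x00.
  by rewrite size_polyX.
by exists t; split => // x; rewrite poly_opC ripZl rip_nrm hornerC.
Qed.

Lemma rip_poly_op_le (p : {poly R}) A (c : R) :
  bounded_op A -> symmetric_op A ->
  (forall t : R, spectrum A t%:C -> p.[t] <= c) ->
  forall x, rip (poly_op p A x) x <= c * nrm x ^+ 2.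
Proof.
move=> bA sA hc x; have [->|x0] := eqVneq x 0.
  by rewrite ripC rip0l nrm0 expr0n mulr0.
have [t [st ht]] := numerical_sup_spectrum p bA sA x0.
by apply: le_trans (ht x) _; rewrite ler_wpM2r ?sqr_ge0 // hc.
Qed.

(** By symmetry the squared norm of [p(A) x] is the form of [p ^+ 2] at [x], so the bound on forms
    suffices. *)
Lemma nrm_poly_op_le (p : {poly R}) A (c : R) :
  bounded_op A -> symmetric_op A -> 0 <= c ->
  (forall t : R, spectrum A t%:C -> `|p.[t]| <= c) ->
  forall x, nrm (poly_op p A x) <= c * nrm x.
Proof.
move=> bA sA c0 hc x; have [lA _] := bA.
rewrite -(@ler_pXn2r _ 2) ?nnegrE ?mulr_ge0 ?nrm_ge0 //.
rewrite -rip_nrm -symmetric_poly_op // ripC -poly_opM // exprMn ripC.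
apply: rip_poly_op_le => // t /hc; rewrite hornerM -expr2 => h.
by rewrite -(real_normK (num_real p.[t])) ler_pXn2r ?nnegrE.
Qed.

End SpectralBound.

(** * Bernstein approximation *)

Section Bernstein.
Context {R : realType}.
Implicit Types (a b : nat -> R).

(* Bernstein polynomial of the values a 0, ..., a n, through de Casteljau's
   recursion. *)
Fixpoint bernstein n a : {poly R} :=
  if n is m.+1 then
    (1 - 'X) * bernstein m a + 'X * bernstein m (fun k => a k.+1)
  else (a 0)%:P.

Lemma bernsteinS n a (x : R) : (bernstein n.+1 a).[x] =
  (1 - x) * (bernstein n a).[x] + x * (bernstein n (fun k => a k.+1)).[x].
Proof. by rewrite /= !hornerE. Qed.

Lemma bernstein_le n a b (x : R) : 0 <= x <= 1 ->
  (forall k, (k <= n)%N -> a k <= b k) ->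
  (bernstein n a).[x] <= (bernstein n b).[x].
Proof.
move=> /andP[x0 x1]; elim: n a b => [|n IHn] a b ab.
  by rewrite /= !hornerC ab.
rewrite !bernsteinS lerD // ler_wpM2l ?subr_ge0 //; apply: IHn => k kn.
  by rewrite ab // leqW.
exact: ab.
Qed.

(** Second moment of the binomial distribution about [c]. The centre is kept arbitrary because the
    recursion shifts it by 1. *)
Lemma bernstein_quadratic n (u v c x : R) :
  (bernstein n (fun k => u + v * (k%:R - c) ^+ 2)).[x] =
  u + v * ((n%:R * x - c) ^+ 2 + n%:R * x * (1 - x)).
Proof.
elim: n c => [|n IHn] c; first by rewrite /= hornerC; ring.
rewrite bernsteinS IHn.
have -> : (fun k : nat => u + v * (k.+1%:R - c) ^+ 2) =
          (fun k : nat => u + v * (k%:R - (c - 1)) ^+ 2).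
  by apply/funext => k; rewrite -natr1; congr (_ + _ * _ ^+ 2); ring.
by rewrite IHn -natr1; ring.
Qed.

(** The values lie between two quadratics centred at [x]; monotonicity passes to their Bernstein
    polynomials, where the variance contributes [x * (1 - x) / n.+1%:R]. *)
Lemma bernstein_dist n a (x y e C : R) : 0 <= x <= 1 -> 0 <= C ->
  (forall k, (k <= n.+1)%N -> `|a k - y| <= e + C * (k%:R / n.+1%:R - x) ^+ 2) ->
  `|(bernstein n.+1 a).[x] - y| <= e + C / n.+1%:R.
Proof.
move=> x01 C0 ha; have n0 : n.+1%:R != 0 :> R by rewrite pnatr_eq0.
have sq k : (k%:R / n.+1%:R - x) ^+ 2 = n.+1%:R ^- 2 * (k%:R - n.+1%:R * x) ^+ 2.
  by field.
have quad u v : (bernstein n.+1 (fun k => u + v * (k%:R / n.+1%:R - x) ^+ 2)).[x] =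
    u + v * (x * (1 - x) / n.+1%:R).
  under [X in bernstein _ X]eq_fun do rewrite sq mulrA.
  by rewrite bernstein_quadratic; field.
have xx : 0 <= x * (1 - x) / n.+1%:R <= n.+1%:R^-1.
  have /andP[x0 x1] := x01.
  rewrite divr_ge0 ?mulr_ge0 ?subr_ge0 //= ler_pdivrMr ?ltr0n // mulVf //; nra.
rewrite ler_distl; apply/andP; split.
  apply: le_trans (_ : y - e + (- C) * (x * (1 - x) / n.+1%:R) <= _).
    by move: xx => /andP[_ hw]; rewrite mulNr opprD addrA lerD2l lerN2 ler_wpM2l.
  rewrite -quad; apply: bernstein_le => // k /ha; rewrite ler_distl => /andP[+ _].
  by rewrite mulNr opprD addrA.
apply: le_trans (_ : y + e + C * (x * (1 - x) / n.+1%:R) <= _).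
  rewrite -quad; apply: bernstein_le => // k /ha; rewrite ler_distl => /andP[_].
  by rewrite addrA.
by move: xx => /andP[_ hw]; rewrite -addrA lerD2l lerD2l ler_wpM2l.
Qed.

(* Uniform continuity is expressed by a quadratic majorant, the form in which
   the variance of the Bernstein weights gives the error bound. *)
Lemma bernstein_approx (f : R -> R) (K : R) : 0 < K ->
  (forall e : R, 0 < e -> exists2 C : R, 0 <= C & forall s t : R,
     0 <= s <= K -> 0 <= t <= K -> `|f s - f t| <= e + C * (s - t) ^+ 2) ->
  exists p : nat -> {poly R}, forall e : R, 0 < e -> exists N, forall n,
    (N <= n)%N -> forall s : R, 0 <= s <= K -> `|(p n).[s] - f s| <= e.
Proof.
move=> K0 hf.
(* Equally spaced nodes of [[0, K]], with the argument rescaled to [[0, 1]]; degree [n.+1] keeps the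
   spacing well defined. *)
exists (fun n => bernstein n.+1 (fun k => f (K * (k%:R / n.+1%:R))) \Po (K^-1 *: 'X)).
move=> e e0; have e20 : 0 < e / 2 by rewrite divr_gt0.
have [C C0 hC] := hf _ e20.
have D0 : 0 < C * K ^+ 2 + 1 by rewrite ltr_wpDl // mulr_ge0 // sqr_ge0.
have [N hN] := small_invn (divr_gt0 e20 D0).
exists N => n /hN; rewrite ltr_pdivlMr // => hn s /andP[s0 sK].
rewrite horner_comp hornerZ hornerX; set x := K^-1 * s.
have sE : s = K * x by rewrite mulrA mulfV ?gt_eqF // mul1r.
have x01 : 0 <= x <= 1.
  by rewrite /x mulr_ge0 ?invr_ge0 ?(ltW K0) //= mulrC ler_pdivrMr // mul1r.
apply: le_trans (_ : e / 2 + C * K ^+ 2 / n.+1%:R <= _); last first.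
  rewrite [leRHS]splitr lerD2l; apply/ltW; apply: le_lt_trans hn.
  by rewrite mulrC ler_wpM2l ?invr_ge0 // lerDl.
apply: bernstein_dist => //; first by rewrite mulr_ge0 // sqr_ge0.
move=> k kn; rewrite {1}sE; apply: le_trans (hC _ _ _ _) _.
- rewrite mulr_ge0 ?divr_ge0 ?(ltW K0) //= ger_pMr // ler_pdivrMr ?ltr0n // mul1r.
  by rewrite ler_nat.
- by rewrite -sE s0.
- by rewrite -mulrBr exprMn mulrA.
Qed.

End Bernstein.

(** * Existence of the functional calculus *)

Lemma uniform_cvgP (R : realType) (S : set R) (u : nat -> R -> R) (g : R -> R) :
  {uniform S, u @ \oo%classic --> g}%classic <->
  forall e : R, 0 < e -> exists N, forall n, (N <= n)%N ->
    forall s, S s -> `|u n s - g s| <= e.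
Proof.
split=> [ug e e0|ug].
  have /ug [N _ hN] : nbhs (g : {uniform` S -> R})
      [set h : R -> R | forall s, S s -> `|h s - g s| <= e]%classic.
    apply/uniform_nbhs; exists [set xy : R * R | ball xy.1 e xy.2]%classic.
    split; first exact: (entourage_ball _ (PosNum e0)).
    by move=> h /= hh s Ss; rewrite distrC ltW //; exact: hh.
  by exists N.
move=> P /uniform_nbhs[E [+ EP]].
rewrite -entourage_ballE => -[e /= e0 eE].
have [|N hN] := ug (e / 2); first by rewrite divr_gt0.
exists N => // n /= Nn; apply: EP => s Ss; apply: eE.
rewrite /ball /= distrC; apply: le_lt_trans (hN n Nn s Ss) _.
by rewrite ltr_pdivrMr // ltr_pMr // ltr1n.
Qed.

Section FunctionalCalculus.
Context {R : realType} {H : hilbertType R}.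
Implicit Types (x y : H) (A B : H -> H).

Lemma opnormP A x : bounded_op A -> nrm (A x) <= opnorm A * nrm x.
Proof.
move=> /bounded_opP[lA [M M0 hM]].
have [->|x0] := eqVneq x 0; first by rewrite linop0 // nrm0 mulr0.
have nx : 0 < nrm x by rewrite nrm_gt0.
rewrite -ler_pdivrMr // mulrC; apply: ub_le_sup.
  exists M => _ [y /= y1 <-]; apply: le_trans (hM y) _.
  by rewrite ler_piMr // -lecR -nrmE.
exists ((nrm x)^-1%:C *: x).
  rewrite /= nrmE lecR nrmZr ger0_norm ?invr_ge0 ?nrm_ge0 //.
  by rewrite mulVf // gt_eqF.
by rewrite linopZ // -/(nrm _) nrmZr ger0_norm // invr_ge0 nrm_ge0.
Qed.

Lemma opnorm_le A (c : R) : 0 <= c -> (forall x, nrm (A x) <= c * nrm x) ->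
  opnorm A <= c.
Proof.
move=> c0 hc; apply: ge_sup.
  by exists (complex.Re `|A 0|), 0 => //=; rewrite normr0.
move=> _ [y /= y1 <-]; apply: le_trans (hc y) _.
by rewrite ler_piMr // -lecR -nrmE.
Qed.

Lemma opnorm_ge0 A : bounded_op A -> 0 <= opnorm A.
Proof.
move=> /bounded_opP[lA [M M0 hM]]; apply: ub_le_sup.
  exists M => _ [y /= y1 <-]; apply: le_trans (hM y) _.
  by rewrite ler_piMr // -lecR -nrmE.
by exists 0; rewrite /= ?linop0 // normr0.
Qed.

(** Both convergences are read at a common index, giving one polynomial close to [g] on the spectrum
    and to [B] in norm. *)
Lemma is_cfc_approx A (g : R -> R) B : bounded_op A -> is_cfc A g B ->
  forall e : R, 0 < e -> exists p : {poly R},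
    (forall t : R, spectrum A t%:C -> `|p.[t] - g t| <= e) /\
    (forall x, nrm (poly_op p A x - B x) <= e * nrm x).
Proof.
move=> bA [bB [p [/uniform_cvgP ug /cvgrPdist_le cB]]] e e0.
have [N1 h1] := ug e e0; have [N2 _ h2] := cB e e0.
pose n := maxn N1 N2; exists (p n); split; first exact: h1 (leq_maxl _ _).
move=> x; apply: le_trans (@opnormP (poly_op (p n) A - B) x _) _.
  exact/bounded_opB/bB/bounded_poly_op.
rewrite ler_wpM2r ?nrm_ge0 //; have := h2 n (leq_maxr _ _).
by rewrite /= sub0r normrN; apply: le_trans; exact: ler_norm.
Qed.

(** Bernstein polynomials of [g] on an interval containing the spectrum are uniformly Cauchy there,
    hence so are their operators by [nrm_poly_op_le]; completeness of [H] provides the limit. *)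
Lemma cfc_exists A (g : R -> R) : bounded_op A -> symmetric_op A ->
  (forall x, 0 <= rip (A x) x) ->
  (forall K e : R, 0 < K -> 0 < e -> exists2 C : R, 0 <= C & forall s t : R,
     0 <= s <= K -> 0 <= t <= K -> `|g s - g t| <= e + C * (s - t) ^+ 2) ->
  is_cfc A g (cfc g A).
Proof.
move=> bA sA A0 hg; have /bounded_opP[lA [M M0 hM]] := bA.
have M1 : 0 < M + 1 by rewrite ltr_wpDl.
have [p hp] := bernstein_approx M1 (fun e => hg (M + 1) e M1).
have spec t : spectrum A t%:C -> 0 <= t <= M + 1.
  apply: spectrum_range => // x; rewrite mul0r A0 /=.
  apply: le_trans (rip_le _ _) _; rewrite expr2 mulrA ler_wpM2r ?nrm_ge0 //.
  by apply: le_trans (hM x) _; rewrite ler_wpM2r ?nrm_ge0 // lerDl.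
have cau (e : R) : 0 < e -> exists N, forall m n, (N <= m)%N -> (N <= n)%N ->
    forall x, nrm (poly_op (p m) A x - poly_op (p n) A x) <= e * nrm x.
  move=> e0; have [|N hN] := hp (e / 2); first by rewrite divr_gt0.
  exists N => m n Nm Nn x; rewrite -poly_opB.
  apply: nrm_poly_op_le => //; first exact: ltW.
  move=> t /spec ht; rewrite hornerD hornerN (splitr e).
  rewrite (le_trans (ler_distD (g t) _ _)) // lerD ?hN //.
  by rewrite distrC hN.
have [B hB] : {B : H -> H & forall x, forall e : R, 0 < e ->
    exists N, forall n, (N <= n)%N -> nrm (poly_op (p n) A x - B x) < e}.
  apply: (@choice _ _ (fun x z => forall e : R, 0 < e ->
    exists N, forall n, (N <= n)%N -> nrm (poly_op (p n) A x - z) < e)) => x.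
  apply: (@complete_nrm _ _ (fun n => poly_op (p n) A x)) => e e0.
  have x1 : 0 < nrm x + 1 by rewrite ltr_wpDl // nrm_ge0.
  have [|N hN] := cau (e / (nrm x + 1)); first by rewrite divr_gt0.
  exists N => m n Nm Nn; apply: le_lt_trans (hN m n Nm Nn x) _.
  by rewrite mulrAC ltr_pdivrMr // ltr_pM2l // ltrDl.
(* Letting the second index of the Cauchy estimate tend to infinity upgrades pointwise convergence
   to convergence in operator norm. *)
have unif (e : R) : 0 < e -> exists N, forall n, (N <= n)%N ->
    forall x, nrm (poly_op (p n) A x - B x) <= e * nrm x.
  move=> e0; have [N hN] := cau e e0; exists N => n Nn x.
  apply/ler_addgt0Pr => d d0; have [N' hN'] := hB x d d0.
  pose m := maxn N N'.
  rewrite -(subrK (poly_op (p m) A x) (poly_op (p n) A x)) -addrA.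
  apply: le_trans (nrmD _ _) _; apply: lerD.
    exact: hN Nn (leq_maxl _ _) x.
  exact/ltW/hN'/leq_maxr.
have lP n : linear (poly_op (p n) A) by have [] := bounded_poly_op (p n) bA.
have lB : linear B.
  move=> a u v; apply/eqP; rewrite -subr_eq0 -nrm_eq0 eq_le nrm_ge0 andbT.
  pose c : R := nrm (a *: u + v) + nrm (a *: u) + nrm v.
  have c0 : 0 <= c by rewrite !addr_ge0 ?nrm_ge0.
  apply/ler_addgt0Pr => d d0; rewrite add0r.
  have [|N hN] := unif (d / (c + 1)); first by rewrite divr_gt0 // ltr_wpDl.
  have hP := hN N (leqnn N); set P := poly_op (p N) A in hP.
  pose ra : R := complex.Re `|a|.
  have -> : B (a *: u + v) - (a *: B u + B v) =
     - (P (a *: u + v) - B (a *: u + v)) + (a *: (P u - B u) + (P v - B v)).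
    by rewrite opprB /P (lP N) scalerBr (addrACA (a *: _)) -opprD addrA subrK.
  apply: le_trans (nrmD _ _) _; rewrite nrmN.
  apply: le_trans (lerD (hP _) (nrmD _ _)) _; rewrite nrmZ.
  apply: le_trans (lerD (lexx _) (lerD (ler_wpM2l _ (hP u)) (hP v))) _.
    by rewrite normc_def /= sqrtr_ge0.
  rewrite mulrCA -nrmZ -!mulrDr addrA -/c mulrAC ler_pdivrMr ?ltr_wpDl //.
  by rewrite ler_pM2l // lerDl.
have bB : bounded_op B.
  have [N hN] := unif 1 ltr01.
  have /bounded_opP[_ [L L0 hL]] := bounded_poly_op (p N) bA.
  apply/bounded_opP; split => //; exists (1 + L); first by rewrite addr_ge0.
  move=> x; rewrite -(subrK (poly_op (p N) A x) (B x)) mulrDl.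
  by apply: le_trans (nrmD _ _) _; rewrite lerD // nrmB hN.
suff : ([set B | is_cfc A g B] (cfc g A))%classic by [].
apply: (@xgetPex _ 0); exists B; split => //; exists p; split.
  apply/uniform_cvgP => e e0; have [N hN] := hp e e0.
  by exists N => n Nn s /= /spec; exact: hN.
apply/cvgrPdist_le => e e0; have [N hN] := unif e e0.
exists N => // n /= Nn; rewrite sub0r normrN ger0_norm.
  by apply: opnorm_le; [exact: ltW|exact: hN].
exact/opnorm_ge0/bounded_opB/bB/bounded_poly_op.
Qed.

End FunctionalCalculus.

(** * Positive operators *)

Section PositiveOperators.
Context {R : realType} {H : hilbertType R}.
Implicit Types (x y : H) (A B T S : H -> H).

Lemma positive_spectrum A : bounded_op A -> symmetric_op A ->
  (forall x, 0 <= rip (A x) x) ->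
  exists2 K : R, 0 <= K & forall t : R, spectrum A t%:C -> 0 <= t <= K.
Proof.
move=> bA sA A0; have /bounded_opP[lA [M M0 hM]] := bA.
exists M => // t; apply: spectrum_range => // x; rewrite mul0r A0 /=.
by apply: le_trans (rip_le _ _) _; rewrite expr2 mulrA ler_wpM2r ?nrm_ge0.
Qed.

(** The difference [D] of the roots is at most their sum, so [D ^+ 4 <= (s - t) ^+ 2]; either
    [D <= e], or [e ^+ 3 * D <= D ^+ 4]. *)
Lemma sqrt_modulus (e : R) : 0 < e -> exists2 C : R, 0 <= C & forall s t : R,
  0 <= s -> 0 <= t -> `|Num.sqrt s - Num.sqrt t| <= e + C * (s - t) ^+ 2.
Proof.
move=> e0; exists (e ^- 3) => [|s t s0 t0]; first by rewrite invr_ge0 exprn_ge0 // ltW.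
rewrite -{2}(sqr_sqrtr s0) -{2}(sqr_sqrtr t0).
have := sqrtr_ge0 s; have := sqrtr_ge0 t.
move: (Num.sqrt s) (Num.sqrt t) => p q q0 p0.
pose D : R := `|p - q|; have D0 : 0 <= D by exact: normr_ge0.
have hD : D ^+ 4 <= (p ^+ 2 - q ^+ 2) ^+ 2.
  rewrite subr_sqr exprMn (exprM D 2 2) real_normK ?num_real // [X in X <= _]expr2.
  by rewrite ler_wpM2l ?sqr_ge0 //; nra.
rewrite -/D; apply: le_trans (_ : e + e ^- 3 * D ^+ 4 <= _); last first.
  by rewrite lerD2l ler_wpM2l // invr_ge0 exprn_ge0 // ltW.
rewrite -(@ler_pM2l _ (e ^+ 3)) ?exprn_gt0 // mulrDr mulrA mulfV ?mul1r; last first.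
  by rewrite gt_eqF // exprn_gt0.
have [De|eD] := leP D e.
  apply: le_trans (_ : e ^+ 3 * e <= _); first by rewrite ler_wpM2l // exprn_ge0 // ltW.
  by rewrite lerDl exprn_ge0.
apply: le_trans (_ : D ^+ 3 * D <= _).
  by rewrite ler_wpM2r // ler_pXn2r ?nnegrE // ltW.
by rewrite -exprSr lerDr mulr_ge0 ?exprn_ge0 // ltW.
Qed.

(** With [p] close to the square root, [B (B x)] is close to [P (P x)], and [P (P x)] to [A x]
    because [p ^+ 2 - 'X] is small on the spectrum. *)
Lemma cfc_sqrtK A : bounded_op A -> symmetric_op A ->
  (forall x, 0 <= rip (A x) x) ->
  forall x, cfc Num.sqrt A (cfc Num.sqrt A x) = A x.
Proof.
move=> bA sA A0 x.
have hB : is_cfc A Num.sqrt (cfc Num.sqrt A).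
  apply: cfc_exists => // K e _ e0; have [C C0 hC] := sqrt_modulus e0.
  by exists C => // s t /andP[s0 _] /andP[t0 _]; exact: hC.
set B := cfc Num.sqrt A in hB *.
have [K K0 hK] := positive_spectrum bA sA A0.
have [/bounded_opP[lB [L L0 hL]] _] := hB.
have [lA _] := bA.
apply/eqP; rewrite -subr_eq0 -nrm_eq0 eq_le nrm_ge0 andbT.
apply/ler_addgt0Pr => d d0; rewrite add0r.
pose c : R := (1 + (L + 1) + L) + (2 * Num.sqrt K + 1).
have c0 : 0 < c * nrm x + 1.
  by rewrite ltr_wpDl // mulr_ge0 ?nrm_ge0 // !addr_ge0 ?mulr_ge0 ?sqrtr_ge0.
(* The cap 1 bounds [P] by [L + 1] and the sum of [p.[t]] and the root by [2 * Num.sqrt K + 1]; [c]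
   collects both constants. *)
pose e : R := Num.min 1 (d / (c * nrm x + 1)).
have e0 : 0 < e by rewrite lt_min ltr01 divr_gt0.
have e1 : e <= 1 by rewrite ge_min lexx.
have ed : e * (c * nrm x + 1) <= d by rewrite -ler_pdivlMr // ge_min lexx orbT.
have [p [hp hP]] := is_cfc_approx bA hB e0.
set P := poly_op p A in hP.
have [lP _] : bounded_op P by exact: bounded_poly_op.
have PL y : nrm (P y) <= (L + 1) * nrm y.
  rewrite -(subrK (B y) (P y)); apply: le_trans (nrmD _ _) _.
  rewrite mulrDl addrC lerD // mul1r; apply: le_trans (hP y) _.
  by rewrite -[leRHS]mul1r ler_wpM2r ?nrm_ge0.
have h1 : nrm (P (P x) - A x) <= e * (2 * Num.sqrt K + 1) * nrm x.
  rewrite /P -poly_opM // -(poly_opX x lA) -poly_opB.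
  apply: nrm_poly_op_le => //.
    by rewrite mulr_ge0 ?(ltW e0) // addr_ge0 // mulr_ge0 ?sqrtr_ge0.
  move=> t st; have /andP[t0 tK] := hK t st.
  rewrite hornerD hornerN hornerX hornerM -expr2 -{2}(sqr_sqrtr t0) subr_sqr normrM.
  have pt := hp t st; rewrite ler_pM // -(subrK (Num.sqrt t) p.[t]) -addrA.
  apply: le_trans (ler_normD _ _) _; rewrite [leRHS]addrC; apply: lerD.
    exact: le_trans pt e1.
  have -> : Num.sqrt t + Num.sqrt t = 2 * Num.sqrt t by ring.
  by rewrite ger0_norm ?mulr_ge0 ?sqrtr_ge0 // ler_pM2l // ler_wsqrtr.
have h2 : nrm (B (B x) - P (P x)) <= e * (L + (L + 1)) * nrm x.
  rewrite -(subrK (P (B x)) (B (B x))) -addrA.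
  apply: le_trans (nrmD _ _) _; rewrite mulrDr mulrDl lerD //.
    by rewrite nrmB -mulrA; apply: le_trans (hP _) _; rewrite ler_wpM2l // ltW.
  rewrite -linopB //; apply: le_trans (PL _) _.
  by rewrite (mulrC e) -mulrA ler_wpM2l ?addr_ge0 // nrmB.
rewrite -(subrK (P (P x)) (B (B x))) -addrA.
apply: le_trans (nrmD _ _) _; apply: le_trans (lerD h2 h1) _; apply: le_trans ed.
rewrite -mulrDl -mulrDr -mulrA ler_wpM2l ?(ltW e0) //.
apply: le_trans (_ : c * nrm x <= _); last by rewrite lerDl.
by rewrite ler_wpM2r ?nrm_ge0 // /c lerD2r; lra.
Qed.

(* The hypothesis is the existence of a supporting line of the convex function
   g at the point <Ax, x>. *)
Lemma jensen_cfc A (g : R -> R) B x (m : R) :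
  bounded_op A -> symmetric_op A -> (forall x, 0 <= rip (A x) x) ->
  is_cfc A g B -> nrm x = 1 ->
  (forall s : R, 0 <= s -> g (rip (A x) x) + m * (s - rip (A x) x) <= g s) ->
  g (rip (A x) x) <= rip (B x) x.
Proof.
move=> bA sA A0 gB x1 hm; have [lA _] := bA.
have [K K0 hK] := positive_spectrum bA sA A0.
apply/ler_addgt0Pr => e e0; have e20 : 0 < e / 2 by rewrite divr_gt0.
have [p [hp hP]] := is_cfc_approx bA gB e20.
set a : R := rip (A x) x in hm *.
(* Supporting line minus [p]: on the spectrum the line lies below [g], which lies below
   [p + e / 2]. *)
pose q : {poly R} := (g a - m * a)%:P + m%:P * 'X - p.
have : rip (poly_op q A x) x <= e / 2 * nrm x ^+ 2.
  apply: rip_poly_op_le => // t st; have /andP[t0 _] := hK t st.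
  rewrite /q !hornerE; have := hp t st; rewrite ler_distl => /andP[h1 h2].
  by have := hm t t0; lra.
rewrite /q poly_opB poly_opD poly_opM // !poly_opC poly_opX //.
rewrite x1 expr1n mulr1 ripBl ripDl !ripZl rip_nrm x1 -/a expr1n mulr1 => h.
have : rip (poly_op p A x - B x) x <= e / 2.
  apply: le_trans (rip_le _ _) _; rewrite x1 mulr1.
  by apply: le_trans (hP x) _; rewrite x1 mulr1.
rewrite ripBl; move: h; lra.
Qed.

Lemma gramP T : bounded_op T ->
  [/\ bounded_op (adjoint T \o T), symmetric_op (adjoint T \o T) &
      forall x, rip (adjoint T (T x)) x = nrm (T x) ^+ 2].
Proof.
move=> bT; have [bT' hT] := adjointP bT.
have rT x y : rip (adjoint T x) y = rip x (T y).
  by rewrite ripC /rip -hT -/(rip _ _) ripC.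
split; first exact: bounded_op_comp.
  by move=> x y /=; rewrite rT ripC -rT ripC.
by move=> x; rewrite rT rip_nrm.
Qed.

(** Only even powers of [absop] occur in the final inequality, so this removes every square root
    from it. *)
Lemma absop_iter2 T : bounded_op T -> iter 2 (absop T) = adjoint T \o T.
Proof.
move=> bT; have [bA sA hA] := gramP bT; apply/funext => x.
by apply: (cfc_sqrtK bA sA) => y; rewrite /= hA sqr_ge0.
Qed.

Lemma numrad_ge A x : bounded_op A -> nrm x = 1 ->
  complex.Re `|inner (A x) x| <= numrad A.
Proof.
move=> /bounded_opP[lA [M M0 hM]] x1; apply: ub_le_sup.
  exists M => _ [y /= y1 <-].
  have {}y1 : nrm y = 1 by rewrite /nrm y1.
  by apply: le_trans (inner_le _ _) _; have := hM y; rewrite y1 !mulr1.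
by exists x => //=; rewrite nrmE x1.
Qed.

Lemma numrad_ge0 A : 0 <= numrad A.
Proof.
rewrite /numrad; set S := image _ _.
(* A set that is empty or unbounded above has the default supremum 0. *)
have [hs|/sup_out ->//] := pselect (has_sup S).
have [[v Sv] ubS] := hs; apply: le_trans (ub_le_sup ubS Sv).
by case: Sv => x _ <-; rewrite normc_def /= sqrtr_ge0.
Qed.

(** Positivity of [numrad A] excludes the default value of the supremum. *)
Lemma numrad_adherent A (e : R) : 0 < e -> 0 < numrad A ->
  exists2 x, nrm x = 1 & numrad A - e < complex.Re `|inner (A x) x|.
Proof.
move=> e0 A0.
pose V : set R :=
  [set complex.Re `|inner (A x) x| | x in [set x : H | `|x| = 1]]%classic.
have [hs|/sup_out A00] := pselect (has_sup V).
  have [_ [x /= x1 <-] hx] := sup_adherent e0 hs.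
  by exists x => //; rewrite /nrm x1.
by move: A0; rewrite /numrad -/V A00 ltxx.
Qed.

End PositiveOperators.

(** * Orlicz functions *)

Section Orlicz.
Context {R : realType} {phi : R -> R} (ophi : orlicz phi).

Lemma orlicz_conv (a b s : R) : 0 <= a -> 0 <= b -> 0 <= s -> s <= 1 ->
  phi (s * a + (1 - s) * b) <= s * phi a + (1 - s) * phi b.
Proof.
move=> a0 b0 s0 s1.
have := @orlicz_convex _ _ ophi (Itv01 s0 s1) a b.
by apply; rewrite inE /= in_itv /= ?a0 ?b0.
Qed.

Lemma orlicz_mean (a b : R) : 0 <= a -> 0 <= b ->
  phi ((a + b) / 2) <= (phi a + phi b) / 2.
Proof.
move=> a0 b0; have := @orlicz_conv a b (2^-1) a0 b0 _ _.
have -> : 2^-1 * a + (1 - 2^-1) * b = (a + b) / 2 by field.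
have -> : 2^-1 * phi a + (1 - 2^-1) * phi b = (phi a + phi b) / 2 by field.
by apply; lra.
Qed.

Lemma orlicz_le (a b : R) : 0 <= a -> a <= b -> phi a <= phi b.
Proof.
move=> a0 ab; apply: (orlicz_increasing ophi) => //; rewrite in_itv /= ?andbT //.
exact: le_trans ab.
Qed.

(** Monotonicity of chord slopes, with denominators cleared. *)
Lemma orlicz_chord (a b c : R) : 0 <= a -> a < b -> b < c ->
  (phi b - phi a) * (c - b) <= (phi c - phi b) * (b - a).
Proof.
move=> a0 ab bc; have ca : 0 < c - a by rewrite subr_gt0 (lt_trans ab).
have c0 : 0 <= c by rewrite (le_trans a0) // ltW // (lt_trans ab).
pose s : R := (c - b) / (c - a).
have := @orlicz_conv a c s a0 c0 _ _.
have -> : s * a + (1 - s) * c = b by rewrite /s; field; rewrite gt_eqF.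
move=> h; have {h} : phi b <= s * phi a + (1 - s) * phi c.
  apply: h; first by rewrite divr_ge0 ?subr_ge0 ?ltW // (lt_trans ab).
  by rewrite ler_pdivrMr // mul1r lerD2l lerN2 ltW.
rewrite -(ler_pM2l ca).
have -> : (c - a) * (s * phi a + (1 - s) * phi c) = (c - b) * phi a + (b - a) * phi c.
  by rewrite /s; field; rewrite gt_eqF.
nra.
Qed.

(** The slope up to [t] is at most the slope from [t] to [K + 1], an interval of length at least 1
    on which [phi] rises by at most [phi (K + 1)]. *)
Lemma orlicz_lipschitz (K s t : R) : 0 <= s <= K -> 0 <= t <= K ->
  `|phi s - phi t| <= phi (K + 1) * `|s - t|.
Proof.
wlog st : s t / s <= t => [hwlog|] sK tK.
  have [st|/ltW ts] := leP s t; first exact: hwlog.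
  by rewrite distrC [in leRHS]distrC hwlog.
have /andP[s0 _] := sK; have /andP[t0 tK'] := tK.
have phist : phi s <= phi t by exact: orlicz_le.
rewrite distrC ger0_norm ?subr_ge0 // distrC ger0_norm ?subr_ge0 //.
move: st; rewrite le_eqVlt => /predU1P[->|st]; first by rewrite !subrr mulr0.
have tK1 : t < K + 1 by rewrite (le_lt_trans tK') // ltrDl.
have := orlicz_chord s0 st tK1.
have p0 : 0 <= phi t by exact: (orlicz_ge0 ophi).
have aux (u v w d k : R) : u <= v -> 0 <= v -> 0 <= d -> 1 <= k ->
    (v - u) * k <= (w - v) * d -> v - u <= w * d by nra.
by apply: aux => //; lra.
Qed.

(** For [d] the distance of [s] and [t], the Lipschitz bound satisfies
    [L * d <= e + L ^+ 2 / e * d ^+ 2]. *)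
Lemma orlicz_modulus (K e : R) : 0 < K -> 0 < e ->
  exists2 C : R, 0 <= C & forall s t : R,
     0 <= s <= K -> 0 <= t <= K -> `|phi s - phi t| <= e + C * (s - t) ^+ 2.
Proof.
move=> K0 e0; pose L : R := phi (K + 1).
exists (L ^+ 2 / e) => [|s t sK tK]; first by rewrite divr_ge0 ?sqr_ge0 // ltW.
apply: le_trans (orlicz_lipschitz sK tK) _; rewrite -/L.
rewrite -(real_normK (num_real (s - t))); move: `|s - t| => d.
rewrite -(ler_pM2l e0) mulrDr.
have -> : e * (L ^+ 2 / e * d ^+ 2) = (L * d) ^+ 2 by field; rewrite gt_eqF.
nra.
Qed.

(** The slope is the supremum of the left chord slopes at [a], which every right chord slope bounds;
    at [a = 0] slope 0 works. *)
Lemma orlicz_support (a : R) : 0 <= a ->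
  exists m : R, forall s : R, 0 <= s -> phi a + m * (s - a) <= phi s.
Proof.
rewrite le_eqVlt => /predU1P[<-|a0].
  by exists 0 => s s0; rewrite mul0r addr0 (orlicz0 ophi) (orlicz_ge0 ophi).
pose S : set R := [set (phi a - phi s) / (a - s) | s in [set s : R | 0 <= s < a]]%classic.
have ubS c : a < c -> ubound S ((phi c - phi a) / (c - a)).
  move=> ac _ [s /= /andP[s0 sa] <-].
  rewrite ler_pdivrMr ?subr_gt0 // mulrAC ler_pdivlMr ?subr_gt0 //.
  exact: orlicz_chord.
have S0 : (S !=set0)%classic.
  by exists ((phi a - phi 0) / (a - 0)), 0 => //=; rewrite lexx.
exists (sup S) => s s0; have [sa|as_|->] := ltgtP s a.
- have : (phi a - phi s) / (a - s) <= sup S.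
    apply: ub_le_sup; last by exists s => //=; rewrite s0.
    by exists ((phi (a + 1) - phi a) / (a + 1 - a)); apply: ubS; rewrite ltrDl.
  by rewrite ler_pdivrMr ?subr_gt0 //; lra.
- have := ge_sup S0 (ubS _ as_).
  by rewrite ler_pdivlMr ?subr_gt0 //; lra.
- by rewrite subrr mulr0 addr0.
Qed.

End Orlicz.

(** * Operator Jensen inequality and the numerical radius inequality *)

Lemma orlicz_jensen (R : realType) (H : hilbertType R) (phi : R -> R)
    (A : H -> H) (x : H) : orlicz phi ->
  bounded_op A -> symmetric_op A -> (forall y, 0 <= rip (A y) y) -> nrm x = 1 ->
  phi (rip (A x) x) <= rip (cfc phi A x) x.
Proof.
move=> ophi bA sA A0 x1.
have hB : is_cfc A phi (cfc phi A) by apply: cfc_exists => //; exact: orlicz_modulus.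
have [m hm] := orlicz_support ophi (A0 x).
exact: jensen_cfc hm.
Qed.

Lemma rip_le_opnorm (R : realType) (H : hilbertType R) (A : H -> H) (x : H) :
  bounded_op A -> nrm x = 1 -> rip (A x) x <= opnorm A.
Proof.
move=> bA x1; apply: le_trans (rip_le _ _) _; rewrite x1 mulr1.
by apply: le_trans (opnormP _ bA) _; rewrite x1 mulr1.
Qed.

Lemma bounded_cfc_orlicz (R : realType) (H : hilbertType R) (phi : R -> R)
    (A : H -> H) : orlicz phi ->
  bounded_op A -> symmetric_op A -> (forall y, 0 <= rip (A y) y) ->
  bounded_op (cfc phi A).
Proof.
move=> ophi bA sA A0.
by have [] : is_cfc A phi (cfc phi A) by apply: cfc_exists => //; exact: orlicz_modulus.
Qed.

(** Midpoint convexity, then Jensen for each operator. It serves twice: for the Gram operators of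
    [T] and [S], and for their squares. *)
Lemma opnorm_orlicz_sum (R : realType) (H : hilbertType R) (phi : R -> R)
    (A B : H -> H) (x : H) : orlicz phi ->
  bounded_op A -> symmetric_op A -> (forall y, 0 <= rip (A y) y) ->
  bounded_op B -> symmetric_op B -> (forall y, 0 <= rip (B y) y) ->
  nrm x = 1 ->
  phi ((rip (A x) x + rip (B x) x) / 2) <= opnorm (cfc phi A + cfc phi B) / 2.
Proof.
move=> ophi bA sA A0 bB sB B0 x1.
apply: le_trans (orlicz_mean ophi (A0 x) (B0 x)) _.
rewrite ler_pM2r ?invr_gt0 //.
have hA := orlicz_jensen ophi bA sA A0 x1.
have hB := orlicz_jensen ophi bB sB B0 x1.
apply: le_trans (lerD hA hB) _.
rewrite -ripDl; apply: (@rip_le_opnorm _ _ (cfc phi A + cfc phi B)) => //.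
by apply: bounded_opD; exact: bounded_cfc_orlicz.
Qed.

Theorem theorem2p9 (R : realType) (H : hilbertType R) (T S : H -> H)
    (f : R -> R) (phi : R -> R) (t : R)
    (bT : bounded_op T) (bS : bounded_op S)
    (f_ge0 : forall s : R, s \in `]0, 1[ -> 0 <= f s)
    (phi_orlicz : orlicz phi) (phi_submul : submultiplicative phi)
    (t01 : t \in `]0, 1[) :
  phi (numrad (adjoint T \o S) ^+ 2) <=
    1 / (2 * (1 + f t)) * phi (numrad (adjoint T \o S))
      * opnorm (cfc phi (iter 2 (absop T)) + cfc phi (iter 2 (absop S)))
    + f t / (2 * (1 + f t))
      * phi (numrad (iter 2 (absop S) \o iter 2 (absop T)))
    + f t / (4 * (1 + f t))
      * opnorm (cfc phi (iter 4 (absop T)) + cfc phi (iter 4 (absop S))).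
Proof.
have := f_ge0 t t01; move: (f t) => c c0 {f_ge0 t01 f t}.
have iter4 (U : H -> H) : iter 4 (absop U) = iter 2 (absop U) \o iter 2 (absop U) by [].
rewrite !iter4 !absop_iter2 //.
have [bA sA hA] := gramP bT; have [bB sB hB] := gramP bS.
have [_ hT] := adjointP bT.
set A : H -> H := adjoint T \o T in bA sA *.
set B : H -> H := adjoint S \o S in bB sB *.
have A0 x : 0 <= rip (A x) x by rewrite hA sqr_ge0.
have B0 x : 0 <= rip (B x) x by rewrite hB sqr_ge0.
have sq (C : H -> H) : bounded_op C -> symmetric_op C ->
    [/\ bounded_op (C \o C), symmetric_op (C \o C) &
      forall x, rip (C (C x)) x = nrm (C x) ^+ 2].
  move=> bC sC; split; first exact: bounded_op_comp.
    by move=> x y; rewrite /= !sC.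
  by move=> x; rewrite sC rip_nrm.
have [bA2 sA2 hA2] := sq A bA sA; have [bB2 sB2 hB2] := sq B bB sB.
have A2_0 x : 0 <= rip ((A \o A) x) x by rewrite [rip _ _]hA2 sqr_ge0.
have B2_0 x : 0 <= rip ((B \o B) x) x by rewrite [rip _ _]hB2 sqr_ge0.
set w : R := numrad (adjoint T \o S); set w' : R := numrad (B \o A).
set N2 : R := opnorm _; set N4 : R := opnorm _.
have w0 : 0 <= w by exact: numrad_ge0.
have w'0 : 0 <= w' by exact: numrad_ge0.
have bTS : bounded_op (adjoint T \o S).
  by apply: bounded_op_comp => //; have [] := adjointP bT.
have pos1 := orlicz_ge0 phi_orlicz w0; have pos2 := orlicz_ge0 phi_orlicz w'0.
have c1 : 0 < 1 + c by rewrite ltr_wpDr.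
have N2_0 : 0 <= N2.
  apply: opnorm_ge0; apply: bounded_opD; exact: bounded_cfc_orlicz.
have N4_0 : 0 <= N4.
  apply: opnorm_ge0; apply: bounded_opD; exact: bounded_cfc_orlicz.
pose D : R := 1 / (2 * (1 + c)) * phi w * N2 + c / (2 * (1 + c)) * phi w'
  + c / (4 * (1 + c)) * N4.
rewrite -/D.
(* The right-hand side is the mean of the bounds [e1] and [e2] below, with weights proportional to 1
   and [c]. *)
have DE : D = (phi w * (N2 / 2) + c * ((phi w' + N4 / 2) / 2)) / (1 + c).
  by rewrite /D; field; rewrite gt_eqF.
have half_ge0 (r : R) : 0 <= r -> 0 <= r / 2 by move=> r0; rewrite divr_ge0.
have D0 : 0 <= D.
  rewrite DE; apply: divr_ge0; last exact: ltW.
  apply: addr_ge0; apply: mulr_ge0 => //; first exact: half_ge0.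
  by rewrite half_ge0 // addr_ge0 // half_ge0.
have amgm (p q : R) : p * q <= (q ^+ 2 + p ^+ 2) / 2.
  by have := sqr_ge0 (p - q); rewrite sqrrB; lra.
have key x : nrm x = 1 -> phi (complex.Re `|inner ((adjoint T \o S) x) x| ^+ 2) <= D.
  move=> x1; set v : R := complex.Re _.
  have v0 : 0 <= v by rewrite /v normc_def /= sqrtr_ge0.
  have vw : v <= w by exact: numrad_ge.
  have vE : v <= nrm (S x) * nrm (T x).
    by rewrite /v -[(_ \o _) x]/(adjoint T (S x)) innerC -hT normcJ mulrC inner_le.
  have e1 : phi (v ^+ 2) <= phi w * (N2 / 2).
    apply: le_trans (_ : phi (w * ((rip (A x) x + rip (B x) x) / 2)) <= _).
      apply: (orlicz_le phi_orlicz); first exact: sqr_ge0.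
      by rewrite expr2 ler_pM // (le_trans vE) // hA hB amgm.
    apply: le_trans (phi_submul _ _ w0 _) _; first by rewrite divr_ge0 ?addr_ge0.
    by rewrite ler_wpM2l // opnorm_orlicz_sum.
  have e2 : phi (v ^+ 2) <= (phi w' + N4 / 2) / 2.
    pose u : R := (rip ((A \o A) x) x + rip ((B \o B) x) x) / 2.
    have u0 : 0 <= u by rewrite /u /= hA2 hB2 divr_ge0 ?addr_ge0 ?sqr_ge0.
    apply: le_trans (_ : phi ((w' + u) / 2) <= _).
      apply: (orlicz_le phi_orlicz); first exact: sqr_ge0.
      (* The product of the two forms is the left side of Buzano's inequality for [A x] and
         [B x]. *)
      have v2 : v ^+ 2 <= rip (A x) x * rip x (B x).
        by rewrite -sB hA hB -exprMn ler_pXn2r ?nnegrE ?mulr_ge0 ?nrm_ge0 // mulrC.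
      apply: le_trans v2 _; apply: le_trans (buzano_real _ _ x1) _.
      have ABw : rip (A x) (B x) <= w'.
        rewrite -sB; apply: le_trans (rip_le_inner _ _) _.
        by apply: (@numrad_ge _ _ (B \o A)) => //; exact: bounded_op_comp.
      rewrite ler_pM2r ?invr_gt0 // addrC lerD //.
      by rewrite /u /= hA2 hB2 mulrC amgm.
    apply: le_trans (orlicz_mean phi_orlicz w'0 u0) _.
    have hu : phi u <= N4 / 2.
      exact: (opnorm_orlicz_sum phi_orlicz bA2 sA2 A2_0 bB2 sB2 B2_0 x1).
    have half0 : 0 <= 2^-1 :> R by rewrite invr_ge0.
    exact: (ler_wpM2r half0 (lerD (lexx (phi w')) hu)).
  by rewrite DE ler_pdivlMr // mulrDr mulr1 lerD // mulrC ler_wpM2l.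
(* The case [w = 0] includes the zero space, which has no unit vectors. *)
have [w00|wn0] := eqVneq w 0; first by rewrite w00 expr0n /= (orlicz0 phi_orlicz).
have wp : 0 < w by rewrite lt_def wn0.
apply/ler_addgt0Pr => e e0.
(* Lipschitz constant of [phi] on [[0, w ^+ 2]], used to pass from unit vectors to the supremum. *)
pose L : R := phi (w ^+ 2 + 1).
have L0 : 0 <= L by apply: (orlicz_ge0 phi_orlicz); rewrite addr_ge0 ?sqr_ge0.
(* Since [w ^+ 2 - v ^+ 2 <= (w - v) * (2 * w)], choosing [v] within [e] over this constant of [w]
   costs at most [e] after applying [phi]. *)
have d0 : 0 < L * (2 * w) + 1 by rewrite ltr_wpDl // !mulr_ge0.
have [x x1 hx] := numrad_adherent (divr_gt0 e0 d0) wp.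
set v : R := complex.Re _ in hx.
have v0 : 0 <= v by rewrite /v normc_def /= sqrtr_ge0.
have vw : v <= w by exact: numrad_ge.
have vw2 : v ^+ 2 <= w ^+ 2 by rewrite ler_pXn2r ?nnegrE.
have := key x x1; rewrite -/v => hv.
have : `|phi (w ^+ 2) - phi (v ^+ 2)| <= L * `|w ^+ 2 - v ^+ 2|.
  by apply: orlicz_lipschitz => //; rewrite sqr_ge0 ?lexx ?vw2.
rewrite [X in _ <= _ * X]ger0_norm ?subr_ge0 // => /(le_trans (ler_norm _)) h.
have {}hx : (w - v) * (L * (2 * w) + 1) <= e.
  by rewrite -ler_pdivlMr // lerBlDr -lerBlDl ltW.
have h2 : L * (w ^+ 2 - v ^+ 2) <= (w - v) * (L * (2 * w)).
  rewrite subr_sqr mulrCA ler_wpM2l ?subr_ge0 // ler_wpM2l //.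
  by rewrite mulr_natl mulr2n lerD2l.
have h3 : (w - v) * (L * (2 * w)) <= (w - v) * (L * (2 * w) + 1).
  by rewrite ler_wpM2l ?subr_ge0 // lerDl.
have : phi (w ^+ 2) - phi (v ^+ 2) <= e.
  exact: le_trans h (le_trans h2 (le_trans h3 hx)).
by move=> h4; rewrite -(subrK (phi (v ^+ 2)) (phi (w ^+ 2))) addrC lerD.
Qed.
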